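(* Let $A \in \mathcal{M}_n(\mathbb{H})$ be nilpotent. If $W(A)$ is a (closed) disk $\mathbb{D}_{\mathbb{H}}(c,r)=\{q\in\mathbb{H}: |q-c|\le r\}$ for some $c\in\mathbb{H}$, $r\ge 0$, then its center is the origin, i.e. $W(A)=\mathbb{D}_{\mathbb{H}}(0,r)$.
   Context: $\mathbb{H}$ denotes the real quaternions with basis $1,i,j,k$, $i^2=j^2=k^2=ijk=-1$; for $q\in\mathbb{H}$, $q^*$ is its conjugate and $|q|^2=qq^*$. For $\mathbf{x}\in\mathbb{H}^n$, $\mathbf{x}^*$ is the conjugate transpose, and $\mathbb{S}_{\mathbb{H}^n}=\{\mathbf{x}\in\mathbb{H}^n:\mathbf{x}^*\mathbf{x}=1\}$. The (quaternionic) numerical range of $A\in\mathcal{M}_n(\mathbb{H})$ is $W(A)=\{\mathbf{x}^*A\mathbf{x}:\mathbf{x}\in\mathbb{S}_{\mathbb{H}^n}\}\subseteq\mathbb{H}$. *)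

(* Defs.v *)
From Stdlib Require Import Reals.
From mathcomp Require Import all_boot.

Set Implicit Arguments.
Unset Strict Implicit.
Unset Printing Implicit Defensive.

Open Scope R_scope.

Record quat := Quat { qre : R; qim_i : R; qim_j : R; qim_k : R }.

Definition qzero : quat := Quat 0 0 0 0.
Definition qone  : quat := Quat 1 0 0 0.

Definition qadd (p q : quat) : quat :=
  Quat (qre p + qre q) (qim_i p + qim_i q) (qim_j p + qim_j q) (qim_k p + qim_k q).

Definition qopp (p : quat) : quat :=
  Quat (- qre p) (- qim_i p) (- qim_j p) (- qim_k p).

Definition qsub (p q : quat) : quat := qadd p (qopp q).

(* Hamilton product, i^2 = j^2 = k^2 = ijk = -1 *)
Definition qmul (p q : quat) : quat :=
  let a1 := qre p in let b1 := qim_i p in let c1 := qim_j p in let d1 := qim_k p in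
  let a2 := qre q in let b2 := qim_i q in let c2 := qim_j q in let d2 := qim_k q in
  Quat (a1*a2 - b1*b2 - c1*c2 - d1*d2)
       (a1*b2 + b1*a2 + c1*d2 - d1*c2)
       (a1*c2 - b1*d2 + c1*a2 + d1*b2)
       (a1*d2 + b1*c2 - c1*b2 + d1*a2).

Definition qconj (p : quat) : quat :=
  Quat (qre p) (- qim_i p) (- qim_j p) (- qim_k p).

Definition qnorm (p : quat) : R :=
  sqrt (qre p * qre p + qim_i p * qim_i p + qim_j p * qim_j p + qim_k p * qim_k p).

Definition qmat (n : nat) := 'I_n -> 'I_n -> quat.
Definition qvec (n : nat) := 'I_n -> quat.

Definition qsum (n : nat) (F : 'I_n -> quat) : quat :=
  \big[qadd/qzero]_(i < n) F i.

Definition qmxmul (n : nat) (A B : qmat n) : qmat n :=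
  fun i j => qsum (fun k => qmul (A i k) (B k j)).

Definition qmx1 (n : nat) : qmat n :=
  fun i j => if i == j then qone else qzero.

Definition qmxpow (n : nat) (A : qmat n) (k : nat) : qmat n :=
  ssrnat.iter k (qmxmul A) (@qmx1 n).

Definition qnilpotent (n : nat) (A : qmat n) : Prop :=
  exists k : nat, forall i j, qmxpow A k i j = qzero.

Definition qmxvec (n : nat) (A : qmat n) (x : qvec n) : qvec n :=
  fun i => qsum (fun j => qmul (A i j) (x j)).

Definition qdot (n : nat) (x y : qvec n) : quat :=
  qsum (fun i => qmul (qconj (x i)) (y i)).

Definition qsphere (n : nat) (x : qvec n) : Prop := qdot x x = qone.

Definition numrange (n : nat) (A : qmat n) (q : quat) : Prop :=
  exists x : qvec n, qsphere x /\ qdot x (qmxvec A x) = q.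

Definition qdisk (c : quat) (r : R) (q : quat) : Prop := qnorm (qsub q c) <= r.

(* Main.v *)
Require Import Defs.
From Stdlib Require Import Reals Lra.
From mathcomp Require Import all_boot all_order all_algebra.
From mathcomp Require Import ring complex Rstruct.

(** Writing [x = v + j w] with complex [v, w] identifies H^n with C^(2n), turns
    [A] into a nilpotent complex matrix [M], and turns the numerical range of [A]
    into its projection to C; so W(M) is the complex disk of radius [r] whose
    centre [c1] is the complex part of [c].  Put [B = M - c1].  For every
    [|w| = 1] the hermitian matrix [2 r - w^* B - w B^*] is positive semidefinite
    and its form vanishes at a unit vector realising the boundary point
    [c1 + r w]; hence it is singular, and so is [2 r w - B - w^2 B^*].  The
    determinant of the latter is a polynomial in [w] vanishing on the unit
    circle, so it vanishes at [w = 0]: [c1] is an eigenvalue of [M], whence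
    [c1 = 0].  As W(A) is invariant under [q |-> u^* q u] for unit [u], the same
    applies to [u^* c u], which kills the j and k components of [c]. *)

Set Implicit Arguments.
Unset Strict Implicit.
Unset Printing Implicit Defensive.
Import Order.TTheory GRing.Theory Num.Theory.
Local Open Scope ring_scope.

Section ComplexDisk.
Variable C : numClosedFieldType.

(** * Adjoints and sesquilinear forms of complex matrices *)

Definition adjmx m n (A : 'M[C]_(m, n)) : 'M[C]_(n, m) := map_mx Num.conj A^T.

Lemma adjmxK m n (A : 'M[C]_(m, n)) : adjmx (adjmx A) = A.
Proof. by apply/matrixP => i j; rewrite !mxE conjCK. Qed.

Lemma adjmxM m n p (A : 'M[C]_(m, n)) (B : 'M[C]_(n, p)) :
  adjmx (A *m B) = adjmx B *m adjmx A.
Proof. by rewrite /adjmx trmx_mul map_mxM. Qed.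

Lemma adjmxD m n (A B : 'M[C]_(m, n)) : adjmx (A + B) = adjmx A + adjmx B.
Proof. by rewrite /adjmx linearD /= map_mxD. Qed.

Lemma adjmxN m n (A : 'M[C]_(m, n)) : adjmx (- A) = - adjmx A.
Proof. by rewrite /adjmx linearN /= map_mxN. Qed.

Lemma adjmxZ m n a (A : 'M[C]_(m, n)) : adjmx (a *: A) = a^* *: adjmx A.
Proof. by rewrite /adjmx linearZ /= map_mxZ. Qed.

Lemma adjmx1 n : adjmx (1%:M : 'M[C]_n) = 1%:M.
Proof. by rewrite /adjmx trmx1 map_mx1. Qed.

Definition form n (A : 'M[C]_n) (x y : 'cV[C]_n) : C :=
  (adjmx x *m A *m y) 0 0.

Lemma formDl n (A : 'M[C]_n) x x' y :
  form A (x + x') y = form A x y + form A x' y.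
Proof. by rewrite /form adjmxD !mulmxDl mxE. Qed.

Lemma formDr n (A : 'M[C]_n) x y y' :
  form A x (y + y') = form A x y + form A x y'.
Proof. by rewrite /form mulmxDr mxE. Qed.

Lemma formZl n (A : 'M[C]_n) a x y : form A (a *: x) y = a^* * form A x y.
Proof. by rewrite /form adjmxZ -!scalemxAl mxE. Qed.

Lemma formZr n (A : 'M[C]_n) a x y : form A x (a *: y) = a * form A x y.
Proof. by rewrite /form -scalemxAr mxE. Qed.

Lemma formx0 n (A : 'M[C]_n) x : form A x 0 = 0.
Proof. by rewrite /form mulmx0 mxE. Qed.

Lemma form_mxD n (A B : 'M[C]_n) x y :
  form (A + B) x y = form A x y + form B x y.
Proof. by rewrite /form mulmxDr mulmxDl mxE. Qed.

Lemma form_mxZ n a (A : 'M[C]_n) x y : form (a *: A) x y = a * form A x y.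
Proof. by rewrite /form -scalemxAr -scalemxAl mxE. Qed.

Lemma form_adj n (A : 'M[C]_n) x y : form (adjmx A) x y = (form A y x)^*.
Proof.
rewrite /form; have -> : adjmx x *m adjmx A *m y = adjmx (adjmx y *m A *m x).
  by rewrite !adjmxM adjmxK mulmxA.
by rewrite !mxE.
Qed.

Lemma form1_sum n (x : 'cV[C]_n) : form 1%:M x x = \sum_i `|x i 0| ^+ 2.
Proof.
rewrite /form mulmx1 mxE; apply: eq_bigr => i _.
by rewrite !mxE normCK mulrC.
Qed.

Lemma form1_ge0 n (x : 'cV[C]_n) : 0 <= form 1%:M x x.
Proof. by rewrite form1_sum sumr_ge0 // => i _; rewrite exprn_ge0. Qed.

Lemma form1_eq0 n (x : 'cV[C]_n) : form 1%:M x x = 0 -> x = 0.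
Proof.
rewrite form1_sum => /eqP; rewrite psumr_eq0 => [|i _].
  2: by rewrite exprn_ge0.
move=> /allP x0; apply/colP => i; rewrite mxE.
by have := x0 i (mem_index_enum _); rewrite /= expf_eq0 /= normr_eq0 => /eqP.
Qed.

(** Perturb [x] by a small multiple of [h = H x]: since the form vanishes at [x], the first-order
    term [-2 e |h|^2] would make it negative unless [h = 0]. *)
Lemma psd_form_eq0 n (H : 'M[C]_n) (x : 'cV[C]_n) :
  adjmx H = H -> (forall y, 0 <= form H y y) -> form H x x = 0 -> H *m x = 0.
Proof.
move=> Hadj Hpos Hx0; set h := H *m x.
apply: form1_eq0; set a := form 1%:M h h.
have a_ge0 : 0 <= a := form1_ge0 h.
set b := form H h h; have b_ge0 : 0 <= b := Hpos h.
have hHx : form H h x = a by rewrite /a /form mulmx1 -mulmxA.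
have xHh : form H x h = a by rewrite -[H]Hadj form_adj hHx geC0_conj.
have b1_gt0 : 0 < b + 1 by rewrite ltr_wpDl.
(* With [a = e (b + 1)] the form at [x - e h] equals [- e^2 (b + 2)]; the [+ 1] keeps the
   denominator positive even if [b = 0]. *)
pose e := a / (b + 1); have e_ge0 : 0 <= e by rewrite divr_ge0 // ltW.
have := Hpos (x + (- e) *: h).
rewrite formDl !formDr !formZl !formZr Hx0 xHh hHx -/b rmorphN /= geC0_conj //.
have -> : 0 + - e * a + (- e * a + - e * (- e * b)) = - (e ^+ 2 * (b + 2%:R)).
  rewrite /e; field; exact: lt0r_neq0.
rewrite oppr_ge0 pmulr_lle0; last by rewrite ltr_wpDl.
move=> e2; have {e2} : e ^+ 2 == 0 by rewrite eq_le e2 exprn_ge0.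
rewrite expf_eq0 /= mulf_eq0 invr_eq0 (gt_eqF b1_gt0) orbF => /eqP //.
Qed.

Lemma form_normalize n (A : 'M[C]_n) (y : 'cV[C]_n) : y != 0 ->
  exists2 v, form 1%:M v v = 1 & form A y y = form 1%:M y y * form A v v.
Proof.
move=> y0; set s := form 1%:M y y.
have s0 : s != 0 by apply: contraNneq y0 => /form1_eq0 ->.
have s_ge0 : 0 <= s := form1_ge0 y.
set t := sqrtC s; have t2 : t ^+ 2 = s := sqrtCK s.
have t0 : t != 0 by rewrite sqrtC_eq0.
have tc : t^-1^* = t^-1 by rewrite geC0_conj // invr_ge0 sqrtC_ge0.
exists (t^-1 *: y); rewrite formZl formZr tc -/s -?t2; field => //.
Qed.

(** * Polynomials on the unit circle and the determinant of the pencil *)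

Lemma poly_unit_circle_eq0 (p : {poly C}) :
  (forall w, `|w| = 1 -> p.[w] = 0) -> p = 0.
Proof.
move=> p0; apply/eqP/negPn/negP => pN0.
have di (k : nat) : k%:R - 'i != 0 :> C.
  rewrite subr_eq0; apply/eqP => ki; have := sqrCi C.
  by move/eqP; rewrite -ki -subr_eq0 opprK -natrX natr1 pnatr_eq0.
(* The Cayley transform maps the naturals injectively into the unit circle, which gives [size p]
   distinct roots, more than a nonzero [p] can have. *)
pose w (k : nat) : C := (k%:R + 'i) / (k%:R - 'i).
have w_norm k : `|w k| = 1.
  rewrite /w; have -> : k%:R - 'i = (k%:R + 'i)^* :> C.
    by rewrite rmorphD /= conjCi conjC_nat.
  rewrite normf_div norm_conjC divff // normr_eq0.
  by rewrite -conjC_eq0 rmorphD /= conjCi conjC_nat.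
have w_inj : injective w.
  move=> k l /eqP; rewrite /w eqr_div // => /eqP E.
  have : 2%:R * 'i * (l%:R - k%:R) = 0 :> C.
    have -> : 2%:R * 'i * (l%:R - k%:R) =
      (k%:R + 'i) * (l%:R - 'i) - (l%:R + 'i) * (k%:R - 'i) :> C by ring.
    by rewrite E subrr.
  move/eqP; rewrite !mulf_eq0 pnatr_eq0 (negbTE (neq0Ci C)) /= subr_eq0 eqr_nat.
  by move/eqP.
have := @max_poly_roots _ p (map w (iota 0 (size p))) pN0.
rewrite size_map size_iota ltnn map_inj_uniq // iota_uniq => /(_ _ isT) F.
by suff: false by []; apply: F; apply/allP => _ /mapP[k _ ->]; rewrite rootE p0.
Qed.

(** The determinant is the value at [w] of one polynomial, hence identically zero; at [w = 0] the
    matrix is [- B]. *)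
Lemma det_pencil_eq0 n (B : 'M[C]_n) (r : C) :
  (forall w, `|w| = 1 -> \det ((r * w *+ 2)%:M - B - w ^+ 2 *: adjmx B) = 0) ->
  \det B = 0.
Proof.
move=> det0.
pose P : 'M[{poly C}]_n :=
  ((r *+ 2) *: 'X)%:M - map_mx polyC B - 'X^2 *: map_mx polyC (adjmx B).
have evP w : (\det P).[w] = \det ((r * w *+ 2)%:M - B - w ^+ 2 *: adjmx B).
  rewrite -[LHS]/(horner_eval w (\det P)) -det_map_mx; congr (\det _).
  apply/matrixP => i j; rewrite !mxE /= horner_evalE !(hornerE, hornerMn).
  by rewrite mulrnAl.
have P0 : \det P = 0 by apply: poly_unit_circle_eq0 => w /det0; rewrite evP.
have := evP 0; rewrite P0 horner0 mulr0 mul0rn expr0n /= scale0r subr0.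
rewrite raddf0 sub0r -scaleN1r detZ => /esym/eqP.
by rewrite mulf_eq0 signr_eq0 => /eqP.
Qed.

(** * The centre of a disk as an eigenvalue *)

Lemma disk_center_eigenvalue n (M : 'M[C]_n) (c r : C) : 0 <= r ->
  (forall v, form 1%:M v v = 1 -> `|form M v v - c| <= r) ->
  (forall z, `|z - c| <= r -> exists2 v, form 1%:M v v = 1 & form M v v = z) ->
  \det (M - c%:M) = 0.
Proof.
move=> r_ge0 inD Dsub; set B := M - c%:M.
apply: (@det_pencil_eq0 n B r) => w w1.
have ww : w * w^* = 1 by rewrite -normCK w1 expr1n.
have formB v : form B v v = form M v v - c * form 1%:M v v.
  by rewrite /B -[c%:M]scalemx1 -scaleNr form_mxD form_mxZ; ring.
clearbody B; pose H := (r *+ 2)%:M - w^* *: B - w *: adjmx B.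
have formH y : form H y y = r * form 1%:M y y *+ 2
    - w^* * form B y y - (w^* * form B y y)^*.
  rewrite /H -!scaleNr !form_mxD !form_mxZ.
  rewrite -[(r *+ 2)%:M]scalemx1 form_mxZ form_adj.
  rewrite rmorphM /= conjCK; ring.
have Hadj : adjmx H = H.
  rewrite /H !adjmxD !adjmxN !adjmxZ adjmxK.
  rewrite -[(r *+ 2)%:M]scalemx1 adjmxZ adjmx1 conjCK.
  by rewrite rmorphMn /= (geC0_conj r_ge0) addrAC.
have Hpos y : 0 <= form H y y.
  have [->|y0] := eqVneq y 0.
    by rewrite formx0.
  have [v v1 ->] := form_normalize H y0.
  rewrite mulr_ge0 ?form1_ge0 // formH v1 mulr1.
  set z := w^* * _; have zr : `|z| <= r.
    rewrite normrM norm_conjC w1 mul1r formB v1 mulr1; exact: inD.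
  (* For a unit vector the form of [H] is [2 (r - Re z)], and [Re z <= |z| <= r]. *)
  have -> : r *+ 2 - z - z^* = (r - 'Re z) *+ 2.
    by rewrite ReE; field.
  rewrite pmulrn_lge0 // subr_ge0.
  by apply: le_trans zr; rewrite leif_Re_Creal.
(* A unit vector realising the boundary point in direction [w], where [Re z = r]. *)
have [|x x1 Mx] := Dsub (c + r * w).
  by rewrite addrC addKr normrM w1 mulr1 ger0_norm.
have Hx0 : form H x x = 0.
  rewrite formH formB x1 Mx !mulr1.
  have -> : w^* * (c + r * w - c) = r.
    by rewrite addrC addKr mulrCA [w^* * w]mulrC ww mulr1.
  by rewrite (geC0_conj r_ge0); ring.
have Hx := psd_form_eq0 Hadj Hpos Hx0.
(* [det0P] asks for a row vector in the left kernel, so [H x = 0] is used transposed. *)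
apply/eqP; rewrite -det_tr; apply/det0P; exists x^T.
  apply: contra_eq_neq x1 => /(congr1 trmx); rewrite trmxK trmx0 => ->.
  by rewrite formx0 eq_sym oner_eq0.
(* Multiplying [H] by [w] cancels [w^*], leaving an expression polynomial in [w]. *)
have -> : (r * w *+ 2)%:M - B - w ^+ 2 *: adjmx B = w *: H.
  rewrite /H !scalerBr !scalerA ww scale1r -expr2 scale_scalar_mx.
  by rewrite mulrnAr [w * r]mulrC.
by rewrite -trmx_mul -scalemxAl Hx scaler0 trmx0.
Qed.

(** A left eigenvector [v] gives [0 = v M^k = c^k v]. The case [k = 0] is included, as [c^0 = 1]
    would force [v = 0]. *)
Lemma nilpotent_eigenvalue_eq0 n (M : 'M[C]_n) (c : C) k :
  iter k (mulmx M) 1%:M = 0 -> \det (M - c%:M) = 0 -> c = 0.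
Proof.
move=> Mk /eqP /det0P[v v0]; rewrite mulmxBr mul_mx_scalar => /eqP.
rewrite subr_eq0 => /eqP vM.
have : v *m iter k (mulmx M) 1%:M = c ^+ k *: v.
  elim: k {Mk} => [|k IHk] /=; first by rewrite mulmx1 scale1r.
  by rewrite mulmxA vM -scalemxAl IHk scalerA -exprS.
rewrite Mk mulmx0 => /esym/eqP; rewrite scaler_eq0 (negbTE v0) orbF.
by rewrite expf_eq0 => /andP[_ /eqP].
Qed.

End ComplexDisk.

(** * Quaternions as pairs of complex numbers *)

Local Notation RC := (complex Rdefinitions.R).

(** Turns Stdlib real operations into those of the ring structure, where [ring] applies. *)
Definition RringE := (RplusE, RminusE, RmultE, RoppE, R0E, R1E).

Lemma quat_eq (p q : quat) : qre p = qre q -> qim_i p = qim_i q ->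
  qim_j p = qim_j q -> qim_k p = qim_k q -> p = q.
Proof. by case: p q => [? ? ? ?] [? ? ? ?] /= -> -> -> ->. Qed.

(* [q = qc1 q + j * qc2 q], so right multiplication by complex scalars is
   coordinatewise while left multiplication is complex linear. *)
Definition qc1 (q : quat) : RC := Complex (qre q) (qim_i q).
Definition qc2 (q : quat) : RC := Complex (qim_j q) (- qim_k q).
Definition qofc (a b : RC) : quat :=
  Quat (complex.Re a) (complex.Im a) (complex.Re b) (- complex.Im b).

Lemma qofcK1 a b : qc1 (qofc a b) = a.
Proof. by case: a. Qed.

Lemma qofcK2 a b : qc2 (qofc a b) = b.
Proof. by case: b => ? ?; rewrite /qc2 /= opprK. Qed.

Lemma qc1D p q : qc1 (qadd p q) = qc1 p + qc1 q.
Proof. by []. Qed.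

Lemma qc2D p q : qc2 (qadd p q) = qc2 p + qc2 q.
Proof. by congr Complex; rewrite /= RplusE opprD. Qed.

(** This formula and the next come from [z j = j z^*] for complex [z], together with [j^2 = -1]. *)
Lemma qc1M p q : qc1 (qmul p q) = qc1 p * qc1 q - (qc2 p)^* * qc2 q.
Proof.
by congr Complex; rewrite /= !RringE; ring.
Qed.

Lemma qc2M p q : qc2 (qmul p q) = qc2 p * qc1 q + (qc1 p)^* * qc2 q.
Proof.
by congr Complex; rewrite /= !RringE; ring.
Qed.

Lemma qc1J q : qc1 (qconj q) = (qc1 q)^*.
Proof. by []. Qed.

Lemma qc2J q : qc2 (qconj q) = - qc2 q.
Proof. by []. Qed.

Lemma qc1_sum n (F : 'I_n -> quat) : qc1 (qsum F) = \sum_i qc1 (F i).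
Proof. by apply: (big_morph qc1). Qed.

Lemma qc2_sum n (F : 'I_n -> quat) : qc2 (qsum F) = \sum_i qc2 (F i).
Proof. by apply: (big_morph qc2 qc2D); congr Complex; exact: oppr0. Qed.

(** * Complex representation of quaternionic vectors and matrices *)

Definition cvec n (x : qvec n) : 'cV[RC]_(n + n) :=
  col_mx (\col_i qc1 (x i)) (\col_i qc2 (x i)).

Definition qvec_of n (v : 'cV[RC]_(n + n)) : qvec n :=
  fun i => qofc (v (lshift n i) 0) (v (rshift n i) 0).

Lemma qvec_ofK n (v : 'cV[RC]_(n + n)) : cvec (qvec_of v) = v.
Proof.
rewrite -[RHS]vsubmxK; congr col_mx; apply/colP => i.
  by rewrite !mxE qofcK1.
by rewrite !mxE qofcK2.
Qed.

(** Left multiplication by [A] commutes with right complex scalars; this is its complex matrix, with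
    block rows read off [qc1M] and [qc2M]. *)
Definition cmx n (A : qmat n) : 'M[RC]_(n + n) :=
  let A1 := \matrix_(i, j) qc1 (A i j) in
  let A2 := \matrix_(i, j) qc2 (A i j) in
  block_mx A1 (- map_mx Num.conj A2) A2 (map_mx Num.conj A1).

Lemma cmx_vec n (A : qmat n) x : cmx A *m cvec x = cvec (qmxvec A x).
Proof.
rewrite mul_block_col; congr col_mx; apply/colP => i; rewrite !mxE.
  rewrite qc1_sum -big_split /=; apply: eq_bigr => j _.
  by rewrite !mxE qc1M mulNr.
rewrite qc2_sum -big_split /=; apply: eq_bigr => j _.
by rewrite !mxE qc2M.
Qed.

Lemma cmxM n (A B : qmat n) : cmx (qmxmul A B) = cmx A *m cmx B.
Proof.
rewrite mulmx_block; congr block_mx; apply/matrixP => i j; rewrite !mxE.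
- rewrite qc1_sum -big_split /=; apply: eq_bigr => k _.
  by rewrite !mxE qc1M mulNr.
- rewrite qc2_sum rmorph_sum -sumrN -big_split /=; apply: eq_bigr => k _.
  by rewrite !mxE qc2M rmorphD !rmorphM /= conjCK; ring.
- rewrite qc2_sum -big_split /=; apply: eq_bigr => k _.
  by rewrite !mxE qc2M.
- rewrite qc1_sum rmorph_sum -big_split /=; apply: eq_bigr => k _.
  by rewrite !mxE qc1M rmorphB !rmorphM /= conjCK; ring.
Qed.

Lemma cmx1 n : cmx (@qmx1 n) = 1%:M.
Proof.
rewrite (scalar_mx_block n n 1); congr block_mx; apply/matrixP => i j;
  rewrite !mxE /qmx1; case: eqP => _ /=.
- by [].
- by [].
- by rewrite /qc2 /= oppr0 conjC0 oppr0.
- by rewrite /qc2 /= oppr0 conjC0 oppr0.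
- by rewrite /qc2 /= oppr0.
- by rewrite /qc2 /= oppr0.
- by rewrite (_ : qc1 qone = 1) // conjC1.
- by rewrite (_ : qc1 qzero = 0) // conjC0.
Qed.

Lemma cmx_pow n (A : qmat n) k : cmx (qmxpow A k) = iter k (mulmx (cmx A)) 1%:M.
Proof. by elim: k => [|k IHk] /=; rewrite ?cmx1 // cmxM IHk. Qed.

Lemma cmx_eq0 n (A : qmat n) : (forall i j, A i j = qzero) -> cmx A = 0.
Proof.
move=> A0; rewrite /cmx.
have -> : \matrix_(i, j) qc1 (A i j) = 0.
  by apply/matrixP => i j; rewrite !mxE A0.
have -> : \matrix_(i, j) qc2 (A i j) = 0.
  by apply/matrixP => i j; rewrite !mxE A0 /qc2 /= oppr0.
by rewrite map_mx0 oppr0 block_mx_const.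
Qed.

(** * Inner products and numerical ranges in complex coordinates *)

Lemma qc1_dot n (x y : qvec n) :
  qc1 (qdot x y) = (adjmx (cvec x) *m cvec y) 0 0.
Proof.
rewrite /adjmx tr_col_mx map_row_mx mul_row_col !mxE qc1_sum -big_split /=.
by apply: eq_bigr => i _; rewrite !mxE qc1M qc1J qc2J rmorphN /= mulNr opprK.
Qed.

Lemma qdot_qc2 n (x : qvec n) : qc2 (qdot x x) = 0.
Proof.
rewrite qc2_sum big1 // => i _.
by rewrite qc2M qc1J qc2J conjCK; ring.
Qed.

Lemma qsphereE n (x : qvec n) : qsphere x <-> form 1%:M (cvec x) (cvec x) = 1.
Proof.
rewrite /form mulmx1 -qc1_dot; split=> [->|] //.
(* The complex form sees only the [qc1] part of [x^* x]; the j and k parts always vanish. *)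
move: (qdot_qc2 x); rewrite /qsphere.
case: (qdot x x) => a b c d [-> d0] [-> ->].
congr Quat; apply/eqP; rewrite -oppr_eq0; exact/eqP.
Qed.

Lemma qc1_form n (A : qmat n) x :
  qc1 (qdot x (qmxvec A x)) = form (cmx A) (cvec x) (cvec x).
Proof. by rewrite /form -mulmxA cmx_vec qc1_dot. Qed.

(** Splits the disk condition into its two complex components: dropping one projects the disk,
    cancelling one slices it. *)
Lemma qnorm_le (q : quat) (r : R) : Rle 0 r ->
  Rle (qnorm q) r <-> (`|qc1 q| ^+ 2 + `|qc2 q| ^+ 2 <= r%:C%C ^+ 2).
Proof.
move=> r0; have := r0 => /RleP r0'.
rewrite -!add_Re2_Im2 /= -!rmorphXn -!rmorphD /= lecR /qnorm RsqrtE.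
rewrite !(RplusE, RmultE).
set s := (X in Num.sqrt X).
have s0 : 0 <= s by rewrite /s -!expr2 !addr_ge0 // sqr_ge0.
have -> : qre q ^+ 2 + qim_i q ^+ 2 + (qim_j q ^+ 2 + (- qim_k q) ^+ 2) =
  Num.sqrt s ^+ 2 by rewrite sqr_sqrtr // /s; ring.
by rewrite ler_sqr ?nnegrE ?sqrtr_ge0 //; split=> /RleP.
Qed.

Lemma qc1_sub p q : qc1 (qsub p q) = qc1 p - qc1 q.
Proof. by []. Qed.

Lemma qc2_sub p q : qc2 (qsub p q) = qc2 p - qc2 q.
Proof. exact: qc2D. Qed.

Lemma nilpotent_disk_qc1_eq0 n (A : qmat n) (c : quat) (r : R) :
  qnilpotent A -> Rle 0 r -> (forall q, numrange A q <-> qdisk c r q) ->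
  qc1 c = 0.
Proof.
move=> [k Ak] r0 WA.
have rC : 0 <= r%:C%C :> RC by rewrite ler0c; apply/RleP.
apply: (@nilpotent_eigenvalue_eq0 _ _ (cmx A) _ k).
  by rewrite -cmx_pow cmx_eq0.
apply: (disk_center_eigenvalue rC) => [v v1|z zr].
  (* Every complex unit vector lifts to a quaternionic one, so its form value is the [qc1] part of a
     point of the disk. *)
  have := v1; rewrite -[v]qvec_ofK => /qsphereE xs.
  set x := qvec_of v in xs *.
  have /WA : numrange A (qdot x (qmxvec A x)) by exists x.
  rewrite /qdisk => /(qnorm_le _ r0).
  rewrite qc1_sub qc1_form => le.
  rewrite -ler_sqr ?nnegrE //; apply: le_trans le.
  by rewrite lerDl exprn_ge0.
(* Lifting [z] with the second component of [c] makes the quaternionic distance to [c] equal to the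
   complex one. *)
have : qdisk c r (qofc z (qc2 c)).
  apply/(qnorm_le _ r0); rewrite qc1_sub qc2_sub qofcK1 qofcK2 subrr normr0.
  by rewrite expr0n addr0 ler_sqr ?nnegrE.
move=> /WA [x [xs xq]]; exists (cvec x); first exact/qsphereE.
by rewrite -qc1_form xq qofcK1.
Qed.

(** * Quaternion algebra and invariance of the numerical range under unit conjugation *)

Lemma qmulA p q s : qmul p (qmul q s) = qmul (qmul p q) s.
Proof. by apply: quat_eq; rewrite /= !RringE; ring. Qed.

Lemma qmul1q q : qmul qone q = q.
Proof. by apply: quat_eq; rewrite /= !RringE; ring. Qed.

Lemma qmulq1 q : qmul q qone = q.
Proof. by apply: quat_eq; rewrite /= !RringE; ring. Qed.

Lemma qmulDl p q s : qmul (qadd p q) s = qadd (qmul p s) (qmul q s).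
Proof. by apply: quat_eq; rewrite /= !RringE; ring. Qed.

Lemma qmulDr p q s : qmul p (qadd q s) = qadd (qmul p q) (qmul p s).
Proof. by apply: quat_eq; rewrite /= !RringE; ring. Qed.

Lemma qmul0q q : qmul qzero q = qzero.
Proof. by apply: quat_eq; rewrite /= !RringE; ring. Qed.

Lemma qmulq0 q : qmul q qzero = qzero.
Proof. by apply: quat_eq; rewrite /= !RringE; ring. Qed.

Lemma qmulNr p q : qmul p (qopp q) = qopp (qmul p q).
Proof.
by apply: quat_eq; rewrite /= !RringE; ring.
Qed.

Lemma qmulNl p q : qmul (qopp p) q = qopp (qmul p q).
Proof.
by apply: quat_eq; rewrite /= !RringE; ring.
Qed.

Lemma qconjM p q : qconj (qmul p q) = qmul (qconj q) (qconj p).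
Proof.
by apply: quat_eq; rewrite /= !RringE; ring.
Qed.

Lemma qconjK : involutive qconj.
Proof. by move=> q; apply: quat_eq; rewrite //= RoppE opprK. Qed.

Lemma qmul_sumr n p (F : 'I_n -> quat) :
  qmul p (qsum F) = qsum (fun i => qmul p (F i)).
Proof. exact: (big_morph (qmul p) (qmulDr p) (qmulq0 p)). Qed.

Lemma qmul_suml n p (F : 'I_n -> quat) :
  qmul (qsum F) p = qsum (fun i => qmul (F i) p).
Proof.
by apply: (big_morph (qmul^~ p)) => [q s|]; rewrite ?qmulDl ?qmul0q.
Qed.

Lemma eq_qsum n (F G : 'I_n -> quat) : F =1 G -> qsum F = qsum G.
Proof. by move=> FG; apply: eq_bigr. Qed.

Lemma qdot_conj n (x y : qvec n) u :
  qdot (fun i => qmul (x i) u) (fun i => qmul (y i) u) =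
  qmul (qmul (qconj u) (qdot x y)) u.
Proof.
rewrite /qdot qmul_sumr qmul_suml; apply: eq_qsum => i.
by rewrite qconjM !qmulA.
Qed.

(** Replace the unit vector [x] by [x u]: right multiplication commutes with the action of [A]. *)
Lemma numrange_conj n (A : qmat n) u q : qmul (qconj u) u = qone ->
  numrange A q -> numrange A (qmul (qmul (qconj u) q) u).
Proof.
move=> u1 [x [xs <-]]; exists (fun i => qmul (x i) u); split.
  by rewrite /qsphere qdot_conj xs qmulq1.
rewrite -qdot_conj; apply: eq_qsum => i; congr qmul.
by rewrite /qmxvec qmul_suml; apply: eq_qsum => j; rewrite qmulA.
Qed.

Lemma qnorm_conj u q : qmul (qconj u) u = qone ->
  qnorm (qmul (qmul (qconj u) q) u) = qnorm q.
Proof.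
move=> [u1 _ _ _]; rewrite /qnorm; congr sqrt; move: u1.
case: u q => [a b c d] [e f g h]; rewrite /= !RringE.
(* [N] is [|u|^2]; conjugation multiplies the squared norm by [N^2]. *)
set N := (X in X = _) => N1.
have {}N1 : N = 1 by [].
set S := (X in _ = X); have -> : S = N ^+ 2 * S by rewrite N1 expr1n mul1r.
rewrite /N /S; ring.
Qed.

Lemma qunitJ u : qmul (qconj u) u = qone -> qmul u (qconj u) = qone.
Proof.
move=> <-; apply: quat_eq; rewrite /= !RringE; ring.
Qed.

(** Conjugation by [u] is an isometric bijection, with inverse the conjugation by [u^*]; it
    preserves the numerical range and moves the centre. *)
Lemma numrange_disk_conj n (A : qmat n) c r u : qmul (qconj u) u = qone ->
  (forall q, numrange A q <-> qdisk c r q) ->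
  forall q, numrange A q <-> qdisk (qmul (qmul (qconj u) c) u) r q.
Proof.
move=> u1 WA q; have u1' := qunitJ u1.
have qK p : qmul (qmul (qconj u) (qmul (qmul u p) (qconj u))) u = p.
  by rewrite -!qmulA u1 qmulq1 qmulA u1 qmul1q.
have -> : qdisk (qmul (qmul (qconj u) c) u) r q <->
    qdisk c r (qmul (qmul u q) (qconj u)).
  rewrite /qdisk -(qnorm_conj (qsub _ c) u1) /qsub.
  by rewrite qmulDr qmulDl qK qmulNr qmulNl.
rewrite -WA; split=> [Wq|].
  have := @numrange_conj _ A (qconj u) q; rewrite qconjK; exact.
by move/(numrange_conj u1); rewrite qK.
Qed.

(** * Vanishing of all components of the centre *)

Open Scope R_scope.

Theorem theorem3p1 (n : nat) (A : qmat n) (c : quat) (r : R) :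
  qnilpotent A -> 0 <= r ->
  (forall q, numrange A q <-> qdisk c r q) ->
  c = qzero /\ (forall q, numrange A q <-> qdisk qzero r q).
Proof.
move=> nilA r0 WA; suff c0 : c = qzero by split=> // q; rewrite -c0.
(* The real and i-components of every unit conjugate of [c] vanish. *)
have conj0 u (u1 : qmul (qconj u) u = qone) :=
  nilpotent_disk_qc1_eq0 nilA r0 (numrange_disk_conj u1 WA).
have [c1 ci] : qre c = 0 /\ qim_i c = 0.
  by have [-> ->] := nilpotent_disk_qc1_eq0 nilA r0 WA.
(* Conjugation by [(3 i + 4 j) / 5] is a half-turn; the i-component of its value at
   [c] is [24/25] times the j-component of [c] once the i-component vanishes. *)
have cj : qim_j c = 0.
  pose u := Quat 0 (3/5) (4/5) 0.
  have /conj0[_] : qmul (qconj u) u = qone.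
    by apply: quat_eq => /=; lra.
  by rewrite ci -[GRing.zero]/(0 : R) /=; lra.
have ck : qim_k c = 0.
  (* The half-turn about [(3 i + 4 k) / 5] similarly yields [24/25] times the k-component. *)
  pose u := Quat 0 (3/5) 0 (4/5).
  have /conj0[_] : qmul (qconj u) u = qone.
    by apply: quat_eq => /=; lra.
  by rewrite ci -[GRing.zero]/(0 : R) /=; lra.
exact: quat_eq.
Qed.
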